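(* Fix $k>-1$ and $\ell\in\mathbb{N}$, and let $a_\ell=a_\ell(y,r)$ be a solution of the recurrence relation given in the context. The zeros $j_{k+1+\ell,n}$ correspond to intersections between the graphs of $F_k$ and $G_{k,1+\ell}$, where $G_{k,1+\ell}(r)$ is found by solving $a_\ell(G_{k,1+\ell},r)=0$. In particular, $$G_{k,2}(r)=2(k+1),$$ $$G_{k,3}(r)=2(k+1)-\frac{r^2}{2(k+2)},$$ $$G_{k,4}(r)=2(k+1)-\frac{2(k+3)\,r^2}{\left(4(k+2)(k+3)-r^2\right)},$$ $$G_{k,5}(r)=2(k+1)-\frac{\left(4(k+3)(k+4)-r^2\right)r^2}{4(k+3)\left(2(k+2)(k+4)-r^2\right)},$$ $$G_{k,6}(r)=2(k+1)-\frac{4(k+4)\left(2(k+3)(k+5)-r^2\right)r^2}{\left(16(k+5)(k+4)(k+3)(k+2)-12(k+3)(k+4)r^2+r^4\right)},$$ $$G_{k,7}(r)=2(k+1)-\frac{\left(16(k+6)(k+5)(k+4)(k+3)-12(k+5)(k+4)r^2+r^4\right)r^2}{2(k+4)\left(16(k+6)(k+5)(k+3)(k+2)-16(k+5)(k+3)r^2+3r^4\right)}.$$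
   Context: $J_k(r)$ denotes the Bessel function of the first kind of real index $k$, and $j_{k,n}$, $n\in\mathbb{N}=\{1,2,\dots\}$, denote its positive zeros in increasing order, $0<j_{k,1}<j_{k,2}<\cdots$. For $k>-1$ and $r>0$ define $$F_k(r):=\frac{r\,J_k(r)}{J_{k+1}(r)}.$$ For fixed $k>-1$, the recurrence relation for $a_\ell=a_\ell(y,r)$ is $$a_{\ell+2}=2(k+2+\ell)\,a_{\ell+1}-r^2a_\ell,\qquad a_0=1,\qquad a_1=2(k+1)-y,$$ for all $\ell\in\mathbb{N}_0=\{0,1,2,\dots\}$ and $r>0$. When $y=F_k(r)$, the function $r^\ell J_{k+1+\ell}(r)/J_{k+1}(r)$ is the solution $a_\ell$ of this recurrence; in the definition of $G_{k,1+\ell}$, the variable $y$ in $a_\ell(y,r)$ is instead replaced by $G_{k,1+\ell}(r)$, and the equation $a_\ell=0$ is solved for $G_{k,1+\ell}(r)$ as a function of $r$.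
   Formalization: Zeros of J_{k+1+ℓ} that are also zeros of J_{k+1} (these occur for some k, e.g. ℓ=3) are shown to be exactly the common poles of F_k and G_{k,1+ℓ} rather than finite intersections; the formulas for G hold where their denominators are nonzero. *)

(* Defs.v *)
From HB Require Import structures.
From mathcomp Require Export all_boot all_order all_algebra.
From mathcomp Require Export all_classical all_reals all_analysis.

Set Implicit Arguments.
Unset Strict Implicit.
Unset Printing Implicit Defensive.

Import Order.TTheory GRing.Theory Num.Theory.
Import numFieldNormedType.Exports.

Local Open Scope classical_set_scope.
Local Open Scope ring_scope.

(* Euler's integral; it converges only for s > 0. *)
Definition Gamma {R : realType} (s : R) : R :=
  Rintegral (@lebesgue_measure R) `]0, +oo[%classic
    (fun t : R => t `^ (s - 1) * expR (- t)).

Definition bessel_term {R : realType} (k r : R) (m : nat) : R :=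
  (-1) ^+ m / (m`!%:R * Gamma (m%:R + k + 1)) * (r / 2) `^ (m%:R *+ 2 + k).

(* Since Gamma is given by Euler's integral, this is J_k(r) for k > -1 and
   r > 0; other values are meaningless. *)
Definition bessel {R : realType} (k r : R) : R :=
  limn (series (bessel_term k r)).

Definition bessel_zeros {R : realType} (k : R) : set R :=
  [set r | 0 < r /\ bessel k r = 0].

(* j n is the zero usually written j_{k,n+1}. *)
Definition enumerates_bessel_zeros {R : realType} (k : R) (j : nat -> R) : Prop :=
  (forall m n : nat, (m < n)%N -> j m < j n) /\ range j = bessel_zeros k.

Definition F {R : realType} (k r : R) : R := r * bessel k r / bessel (k + 1) r.

Fixpoint a {R : realType} (k : R) (l : nat) (y r : R) : R :=
  match l with
  | 0 => 1
  | l'.+1 =>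
    match l' with
    | 0 => 2 * (k + 1) - y
    | l''.+1 =>
        2 * (k + 2 + l''%:R) * a k l' y r - r ^+ 2 * a k l'' y r
    end
  end.

(* G_{k,m} is obtained from a_{m-1}, for m > 1.  It is a partial function: the
   equation a_{m-1}(y, r) = 0 has degree at most one in y, and it has no solution
   at the poles of G_{k,m}. *)
Definition G_defined {R : realType} (k : R) (m : nat) (r : R) : Prop :=
  exists! y : R, a k m.-1 y r = 0.

(* Arbitrary unless [G_defined k m r]. *)
Definition G {R : realType} (k : R) (m : nat) (r : R) : R :=
  get [set y : R | a k m.-1 y r = 0].

Definition graph_F {R : realType} (k : R) : set (R * R) :=
  [set p | [/\ 0 < p.1, bessel (k + 1) p.1 != 0 & p.2 = F k p.1]].

Definition graph_G {R : realType} (k : R) (m : nat) : set (R * R) :=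
  [set p | [/\ 0 < p.1, G_defined k m p.1 & p.2 = G k m p.1]].

(* The abscissae of the vertical asymptotes shared by the graphs of F_k and
   G_{k,m}, where the graphs meet at infinity.  This set can be nonempty: for
   suitable non-integer k, J_{k+1} and J_{k+4} have a common positive zero. *)
Definition common_poles {R : realType} (k : R) (m : nat) : set R :=
  [set r | [/\ 0 < r, bessel (k + 1) r = 0 & ~ G_defined k m r]].

(* Main.v *)
(* Write a_l(y) = a_l(0) - y aslope_l.  The recurrence
     J_(v+2) = 2 (v + 1) / r J_(v+1) - J_v
   gives
     r^l J_(k+1+l) = a_l(0) J_(k+1) - aslope_l r J_k,
   so that, where J_(k+1) does not vanish, J_(k+1+l) vanishes iff a_l (F_k) does.
   G_(k,l+1) is defined iff aslope_l <> 0, and by the Casoratian identity a_l(0)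
   and aslope_l are never both zero for r > 0.  Where J_(k+1) vanishes, J_k does
   not, so J_(k+1+l) vanishes iff aslope_l does.  Indeed a common zero r of J_k
   and J_(k+1) would be a zero of all J_(k+n), but J_v(r) > 0 for v large. *)
Require Import Defs.
From mathcomp Require Import all_boot all_order all_algebra.
From mathcomp Require Import all_classical all_reals all_analysis.
From mathcomp Require Import measurable_realfun zify ring lra.
Import Order.TTheory GRing.Theory Num.Theory.
Import numFieldNormedType.Exports.
Local Open Scope classical_set_scope.
Local Open Scope ring_scope.

(** * Convergence, functional equation and positivity of the Gamma function *)

Section Gamma_function.
Context {R : realType}.
Implicit Types (s t a b : R).
Notation mu := (@lebesgue_measure R).

Definition Euler_integrand s t : R := t `^ (s - 1) * expR (- t).

Lemma Euler_integrand_ge0 s t : 0 <= Euler_integrand s t.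
Proof. by rewrite mulr_ge0 ?powR_ge0 ?expR_ge0. Qed.

Lemma measurable_Euler_integrand s (D : set R) :
  measurable_fun D (fun t => (Euler_integrand s t)%:E).
Proof.
apply/measurable_EFinP; apply: measurable_funTS; apply: measurable_funM.
  exact: measurable_powR.
exact: measurableT_comp.
Qed.

(** Kept in the extended reals, so that the functional equation can be proved before convergence is
    known. [Gamma] is its [fine], which sends an infinite value to 0. *)
Definition Euler_integral s : \bar R :=
  (\int[mu]_(t in `]0%R, +oo[) (Euler_integrand s t)%:E)%E.

Lemma GammaE s : Gamma s = fine (Euler_integral s).
Proof. by []. Qed.

Lemma continuous_expRN : continuous (fun t : R => expR (- t)).
Proof.
by move=> t; apply: continuous_comp; [exact: opp_continuous|exact: continuous_expR].
Qed.

Lemma cvg_powR s t : 0 < t -> u `^ s @[u --> t] --> t `^ s.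
Proof.
move=> t0; have : derivable (fun u : R => u `^ s) t 1.
  by apply: derivable_powR; rewrite in_itv /= andbT.
by move=> /derivable1_diffP/differentiable_continuous.
Qed.

Lemma Euler_integrand_by_parts s a b : 0 < a -> a < b -> 0 <= s ->
  (\int[mu]_(t in `[a, b]) (Euler_integrand (s + 1) t)%:E =
   (a `^ s * expR (- a) - b `^ s * expR (- b))%:E +
   s%:E * \int[mu]_(t in `[a, b]) (Euler_integrand s t)%:E)%E.
Proof.
move=> a0 ab s0.
have itv_gt0 t : t \in `[a, b] -> 0 < t.
  by rewrite in_itv /= => /andP[/(lt_le_trans a0)].
have b0 := lt_trans a0 ab.
rewrite (_ : (\int[mu]_(t in `[a, b]) (Euler_integrand (s + 1) t)%:E)%E =
    (\int[mu]_(t in `[a, b]) (t `^ s * expR (- t))%:E)%E); last first.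
  by rewrite /Euler_integrand addrK.
rewrite (@integration_by_parts _ (fun u : R => u `^ s) (fun t => - expR (- t))
  (fun t => s * t `^ (s - 1)) (fun t => expR (- t)))//.
- congr (_ + _)%E; first by congr EFin; ring.
  rewrite -ge0_integralZl_EFin//; last 2 first.
    by move=> t _; rewrite lee_fin Euler_integrand_ge0.
    exact: measurable_Euler_integrand.
  rewrite -[RHS]oppeK; congr (- _)%E; rewrite -integral_ge0N; last first.
    by move=> t _; rewrite -EFinM lee_fin mulr_ge0// Euler_integrand_ge0.
  apply: eq_integral => t _.
  by rewrite -EFinM -EFinN; congr EFin; rewrite /Euler_integrand; ring.
- apply: derivable_within_continuous => t /itv_gt0 t0.
  by apply: derivableM => //; apply: derivable_powR; rewrite in_itv /= andbT.
- split.
  + move=> t /subset_itv_oo_cc /itv_gt0 t0.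
    by apply: derivable_powR; rewrite in_itv /= andbT.
  + by apply: cvg_at_right_filter; exact: cvg_powR.
  + by apply: cvg_at_left_filter; exact: cvg_powR.
- move=> t /subset_itv_oo_cc /itv_gt0 t0.
  by rewrite powR_derive1// in_itv /= andbT.
- by apply: continuous_subspaceT; exact: continuous_expRN.
- split.
  + by move=> t _; exact: ex_derive.
  + by apply: cvg_at_right_filter; apply: cvgN; exact: continuous_expRN.
  + by apply: cvg_at_left_filter; apply: cvgN; exact: continuous_expRN.
- move=> t _; rewrite derive1E.
  have -> : 'D_1 (fun u : R => - expR (- u)) t = - (expR (- t) * -1).
    exact: derive_val.
  by rewrite mulrN1 opprK.
Qed.

(** Monotone convergence along compact intervals that exhaust the half-line and stay away from 0.
    The shift to n + 2 keeps the two endpoints distinct, as [Euler_integrand_by_parts] requires. *)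
Lemma Euler_integral_cvg s :
  (\int[mu]_(t in `[n.+2%:R^-1%R, n.+2%:R%R]) (Euler_integrand s t)%:E)%E @[n --> \oo]
    --> Euler_integral s.
Proof.
have -> : Euler_integral s = (\int[mu]_(t in \bigcup_n [set` `[n.+2%:R^-1, n.+2%:R]%R])
    (Euler_integrand s t)%:E)%E.
  rewrite /Euler_integral; congr (integral _ _ _); apply/seteqP; split=> t /=.
    (* A bound for the sum exceeds both t and its inverse, which places t above the left endpoint
       and below the right one. *)
    rewrite in_itv /= andbT => t0; exists (Num.bound (t + t^-1)) => //=.
    have /archi_boundP : 0 <= t + t^-1 by rewrite ltW// addr_gt0// invr_gt0.
    set n := Num.bound _ => tn; have {}tn : t + t^-1 < n.+2%:R.
      by apply: (lt_le_trans tn); rewrite ler_nat -addn2 leq_addr.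
    have t'0 : 0 < t^-1 by rewrite invr_gt0.
    by rewrite in_itv /= invf_ple ?posrE//; apply/andP; split; lra.
  case=> n _; rewrite /= !in_itv /= andbT => /andP[+ _].
  by apply: lt_le_trans; rewrite invr_gt0.
apply: ge0_nondecreasing_set_cvg_integral => //.
- move=> m n mn; apply/subsetPset => t /=.
  rewrite !in_itv /= => /andP[mt tm]; apply/andP; split.
    by apply: le_trans mt; rewrite lef_pV2 ?posrE// ler_nat !ltnS.
  by apply: (le_trans tm); rewrite ler_nat !ltnS.
- by move=> n; exact: measurable_Euler_integrand.
- by move=> n t _; rewrite lee_fin Euler_integrand_ge0.
Qed.

Lemma cvg_inv_addn2 : (n.+2%:R^-1 : R) @[n --> \oo] --> 0.
Proof. by have := @cvg_harmonic R; rewrite -(cvg_shiftS _ _). Qed.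

Lemma powR_expRN_cvg0_inv s : 0 < s ->
  (n.+2%:R^-1 `^ s * expR (- n.+2%:R^-1) : R) @[n --> \oo] --> 0.
Proof.
move=> s0; have cvg_powR0 : (n.+2%:R^-1 `^ s : R) @[n --> \oo] --> 0.
  have /cvg_at_rightP := powR_cvg0 s0; apply; split; last exact: cvg_inv_addn2.
  by move=> n; rewrite invr_gt0.
apply: (@squeeze_cvgr _ _ _ _ (cst 0) _ _ _ _ _ cvg_powR0); last exact: cvg_cst.
apply: nearW => n; rewrite mulr_ge0 ?powR_ge0 ?expR_ge0 //=.
by rewrite ler_piMr ?powR_ge0// expR_le1 oppr_le0 invr_ge0.
Qed.

(** For an integer N >= s and x >= 1, the bound exp x >= x^(N+1) / (N+1)! gives x^s exp(-x) <=
    (N+1)! / x. *)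
Lemma powR_expRN_cvg0_nat s : 0 < s ->
  (n.+2%:R `^ s * expR (- n.+2%:R) : R) @[n --> \oo] --> 0.
Proof.
move=> s0; have /ltW sN := archi_boundP (ltW s0).
set N := Num.bound s in sN.
have : (N.+1`!%:R * n.+2%:R^-1 : R) @[n --> \oo] --> (N.+1`!%:R * 0 : R).
  by apply: cvgMl_tmp; exact: cvg_inv_addn2.
rewrite mulr0.
apply: (@squeeze_cvgr _ _ _ _ (cst 0)); last exact: cvg_cst.
apply: nearW => n; rewrite mulr_ge0 ?powR_ge0 ?expR_ge0 //=.
have n0 : 0 < n.+2%:R :> R by rewrite ltr0n.
have f0 : 0 < N.+1`!%:R :> R by rewrite ltr0n fact_gt0.
rewrite expRN ler_pdivrMr ?expR_gt0//.
have pow_le : n.+2%:R `^ s <= n.+2%:R ^+ N :> R.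
  by rewrite -powR_mulrn ?ler0n// ler_powR// ler1n.
apply: (le_trans pow_le).
rewrite (_ : _ ^+ N = N.+1`!%:R * n.+2%:R^-1 * (n.+2%:R ^+ N.+1 / N.+1`!%:R)).
  apply: ler_wpM2l; first by rewrite mulr_ge0 ?invr_ge0 ?ltW.
  by apply: le_trans (expR_ge1Dxn N (ltW n0)); rewrite lerDr.
by rewrite exprS; field; rewrite !gt_eqF.
Qed.

(** Limit of the integration by parts on the compact intervals: both boundary terms tend to 0. *)
Lemma Euler_integralD1 s : 0 < s ->
  Euler_integral (s + 1) = (s%:E * Euler_integral s)%E.
Proof.
move=> s0; have := @Euler_integral_cvg (s + 1).
under eq_fun => n do [rewrite Euler_integrand_by_parts ?(ltW s0) ?invr_gt0//;
  last by rewrite (@lt_le_trans _ _ 1)// ?invf_lt1 ?ltr1n ?ler1n].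
move=> /cvg_unique; apply => //; rewrite -[(s%:E * Euler_integral s)%E]add0e.
apply: cvgeD => //; last by apply: cvgeZl => //; exact: Euler_integral_cvg.
apply: cvg_EFin; first exact: nearW.
by rewrite -(subr0 0); apply: cvgB;
  [exact: powR_expRN_cvg0_inv|exact: powR_expRN_cvg0_nat].
Qed.

Lemma Euler_integral_ge0 s : (0 <= Euler_integral s)%E.
Proof.
by apply: integral_ge0 => t _; rewrite lee_fin Euler_integrand_ge0.
Qed.

Lemma Euler_integral1_lty : (Euler_integral 1 < +oo)%E.
Proof.
(* At s = 1 the integrand is the density of the exponential law of rate 1, whose total mass is 1. *)
have -> : Euler_integral 1 =
    (\int[mu]_(t in `]0%R, +oo[) (exponential_pdf 1 t)%:E)%E.
  apply: eq_integral => t; rewrite inE /= in_itv /= andbT => t0.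
  rewrite exponential_pdfE ?ltW// /Euler_integrand subrr powRr0.
  by rewrite mulN1r.
apply: (@le_lt_trans _ _ (\int[mu]_t (exponential_pdf 1 t)%:E)%E).
  apply: ge0_subset_integral => //.
    by apply/measurable_EFinP; exact: measurable_exponential_pdf.
  by move=> t _; rewrite lee_fin exponential_pdf_ge0.
by rewrite integral_exponential_pdf// ltry.
Qed.

Lemma Euler_integral_nat_lty n : (Euler_integral n.+1%:R < +oo)%E.
Proof.
elim: n => [|n IH]; first exact: Euler_integral1_lty.
by rewrite -natr1 Euler_integralD1// lte_mul_pinfty.
Qed.

(** With n >= s - 1, the power t^(s-1) is at most 1 for t <= 1 and at most t^n for t >= 1. Hence the
    integrand is dominated by the sum of those at the integers 1 and n + 1. *)
Lemma Euler_integral_ge1_lty s : 1 <= s -> (Euler_integral s < +oo)%E.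
Proof.
rewrite -subr_ge0 => s1; have /ltW := archi_boundP s1.
set n := Num.bound (s - 1) => sn.
apply: (@le_lt_trans _ _ (Euler_integral 1 + Euler_integral n.+1%:R)%E); last first.
  by rewrite lte_add_pinfty ?Euler_integral1_lty ?Euler_integral_nat_lty.
rewrite /Euler_integral -ge0_integralD//; last 4 first.
- by move=> t _; rewrite lee_fin Euler_integrand_ge0.
- exact: measurable_Euler_integrand.
- by move=> t _; rewrite lee_fin Euler_integrand_ge0.
- exact: measurable_Euler_integrand.
apply: ge0_le_integral => //.
- by move=> t _; rewrite lee_fin Euler_integrand_ge0.
- exact: measurable_Euler_integrand.
- by apply: emeasurable_funD; exact: measurable_Euler_integrand.
move=> t; rewrite /= in_itv /= andbT => t0.
rewrite -EFinD lee_fin /Euler_integrand -mulrDl ler_wpM2r ?expR_ge0//.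
rewrite subrr powRr0 -natr1 addrK; have [t1|/ltW t1] := leP t 1.
  rewrite -[leLHS]addr0 lerD ?powR_ge0//.
  by rewrite -[leRHS](powRr0 t) ger_powR ?t0//.
by rewrite -[leLHS]add0r lerD// ler_powR.
Qed.

(** An infinite value at s would propagate to s + 1 >= 1 by the functional equation. This spares an
    estimate of the singularity at 0. *)
Lemma Euler_integral_lty s : 0 < s -> (Euler_integral s < +oo)%E.
Proof.
move=> s0; rewrite ltey; apply/eqP => I_y.
have : (Euler_integral (s + 1) < +oo)%E by apply: Euler_integral_ge1_lty; lra.
by rewrite Euler_integralD1// I_y gt0_muley ?lte_fin.
Qed.

(** On [1, 2] the integrand is at least exp(-2). *)
Lemma Euler_integral_ge1_gt0 s : 1 <= s -> (0 < Euler_integral s)%E.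
Proof.
move=> s1.
apply: (@lt_le_trans _ _ (\int[mu]_(t in `[1%R, 2%R]) (Euler_integrand s t)%:E)%E);
    last first.
  apply: ge0_subset_integral => //.
  - exact: measurable_Euler_integrand.
  - by move=> t _; rewrite lee_fin Euler_integrand_ge0.
  - by move=> t; rewrite /= !in_itv /= andbT => /andP[+ _]; exact: lt_le_trans.
apply: (@lt_le_trans _ _ (\int[mu]_(t in `[1%R, 2%R]) (cst (expR (- 2))%:E) t)%E).
  rewrite integral_cst//= lebesgue_measure_itv /= lte_fin ltr1n -EFinB -EFinM.
  by rewrite lte_fin mulr_gt0 ?expR_gt0//; lra.
apply: ge0_le_integral => //.
- by move=> t _; rewrite lee_fin expR_ge0.
- exact: measurable_Euler_integrand.
move=> t; rewrite /= in_itv /= => /andP[t1 t2].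
rewrite lee_fin -[leLHS]mul1r ler_pM ?expR_ge0//.
  by rewrite -[leLHS](powRr0 t) ler_powR//; lra.
by rewrite ler_expR; lra.
Qed.

Lemma GammaD1 s : 0 < s -> Gamma (s + 1) = s * Gamma s.
Proof.
move=> s0; rewrite !GammaE Euler_integralD1// fineM//.
by rewrite ge0_fin_numE ?Euler_integral_ge0 ?Euler_integral_lty.
Qed.

Lemma Gamma_gt0 s : 0 < s -> 0 < Gamma s.
Proof.
move=> s0; rewrite -(pmulr_rgt0 _ s0) -GammaD1// GammaE fine_gt0//.
by rewrite Euler_integral_ge1_gt0 ?Euler_integral_lty//; lra.
Qed.

End Gamma_function.

(** * The Bessel series: convergence, three-term recurrence, absence of common zeros *)

Section Bessel_function.
Context {R : realType}.
Implicit Types (v r : R).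

Lemma bessel_termS v r m : -1 < v -> 0 < r ->
  bessel_term v r m.+1 =
  - ((r / 2) ^+ 2 / (m.+1%:R * (m%:R + v + 1))) * bessel_term v r m.
Proof.
move=> v1 r0; have m0 : 0 <= m%:R :> R by exact: ler0n.
have s0 : 0 < m%:R + v + 1 by lra.
have r20 : 0 < r / 2 by lra.
have G0 := Gamma_gt0 _ s0.
have f0 : 0 < m`!%:R :> R by rewrite ltr0n fact_gt0.
have m1 : 0 < m.+1%:R :> R by rewrite ltr0n.
rewrite /bessel_term.
rewrite (_ : m.+1%:R + v + 1 = (m%:R + v + 1) + 1); last by rewrite -natr1; ring.
rewrite (_ : m.+1%:R *+ 2 + v = 2%:R + (m%:R *+ 2 + v)); last by rewrite -natr1; ring.
rewrite GammaD1// [_ `^ (2%:R + _)]powRD ?(gt_eqF r20) ?implybT// powR_mulrn ?ltW//.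
rewrite factS natrM exprS.
by field; rewrite !gt_eqF.
Qed.

Lemma bessel_term0_ge0 v r : -1 < v -> 0 <= bessel_term v r 0.
Proof.
move=> v1; rewrite /bessel_term expr0 fact0 mul1r mulr_ge0 ?powR_ge0//.
by rewrite mul1r invr_ge0 ltW// Gamma_gt0//; lra.
Qed.

(** Since m + v + 1 >= v + 1, the ratio of consecutive terms is at most that of the exponential
    series at (r/2)^2 / (v + 1), which therefore dominates. *)
Lemma normr_bessel_term v r m : -1 < v -> 0 < r ->
  `|bessel_term v r m| <=
  bessel_term v r 0 * exp_coeff ((r / 2) ^+ 2 / (v + 1)) m.
Proof.
move=> v1 r0; have v10 : 0 < v + 1 by lra.
elim: m => [|m IH].
  by rewrite ger0_norm ?bessel_term0_ge0// /exp_coeff /= expr0 fact0 divr1 mulr1.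
have m0 : 0 <= m%:R :> R by exact: ler0n.
have s0 : 0 < m%:R + v + 1 by lra.
have m1 : 0 < m.+1%:R :> R by rewrite ltr0n.
have f0 : 0 < m`!%:R :> R by rewrite ltr0n fact_gt0.
rewrite bessel_termS// normrM normrN [`|_ / _|]ger0_norm; last first.
  by rewrite divr_ge0 ?sqr_ge0// mulr_ge0 ?ltW.
set x := (r / 2) ^+ 2.
apply: (@le_trans _ _ (x / (m.+1%:R * (v + 1)) *
    (bessel_term v r 0 * exp_coeff (x / (v + 1)) m))).
  rewrite ler_pM ?normr_ge0//.
    by rewrite divr_ge0 ?sqr_ge0// mulr_ge0 ?ltW.
  rewrite ler_wpM2l ?sqr_ge0// lef_pV2 ?posrE ?mulr_gt0//.
  by rewrite ler_pM2l//; lra.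
rewrite le_eqVlt; apply/orP; left; apply/eqP.
rewrite /exp_coeff /= factS natrM exprS.
by field; rewrite !gt_eqF.
Qed.

Lemma is_cvg_bessel_series v r : -1 < v -> 0 < r ->
  cvgn (series (bessel_term v r)).
Proof.
move=> v1 r0; apply: normed_cvg.
pose x := (r / 2) ^+ 2 / (v + 1).
have x0 : 0 <= x by rewrite divr_ge0 ?sqr_ge0//; lra.
apply: (@series_le_cvg _ _ (bessel_term v r 0 *: exp_coeff x)).
- by move=> m; exact: normr_ge0.
- by move=> m; rewrite mulr_ge0 ?bessel_term0_ge0// exp_coeff_ge0.
- by move=> m; exact: normr_bessel_term.
- by apply: is_cvg_seriesZ; exact: is_cvg_series_exp_coeff.
Qed.

Lemma bessel_cvg v r : -1 < v -> 0 < r ->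
  series (bessel_term v r) n @[n --> \oo] --> bessel v r.
Proof. exact: is_cvg_bessel_series. Qed.

(** The recurrence holds power by power. The lowest power r^v cancels here; [bessel_term_recS]
    matches the terms of index m + 1 with the term of index m for v + 2. *)
Lemma bessel_term_rec0 v r : -1 < v -> 0 < r ->
  2 * (v + 1) / r * bessel_term (v + 1) r 0 - bessel_term v r 0 = 0.
Proof.
move=> v1 r0; have v10 : 0 < v + 1 by lra.
have r20 : 0 < r / 2 by lra.
have G0 := Gamma_gt0 _ v10.
rewrite /bessel_term mul0rn expr0 fact0 (add0r (v + 1)) (add0r v).
rewrite GammaD1// powRD ?(gt_eqF r20) ?implybT// powRr1 ?ltW//.
by field; rewrite !gt_eqF.
Qed.

Lemma bessel_term_recS v r m : -1 < v -> 0 < r ->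
  2 * (v + 1) / r * bessel_term (v + 1) r m.+1 - bessel_term v r m.+1 =
  bessel_term (v + 2) r m.
Proof.
move=> v1 r0; have m0 : 0 <= m%:R :> R by exact: ler0n.
have s0 : 0 < m%:R + v + 2 by lra.
have r20 : 0 < r / 2 by lra.
have G0 := Gamma_gt0 _ s0.
have f0 : 0 < m`!%:R :> R by rewrite ltr0n fact_gt0.
have m1 : 0 < m%:R + 1 :> R by lra.
rewrite /bessel_term -[m.+1%:R]natr1.
rewrite (_ : m%:R + 1 + (v + 1) + 1 = (m%:R + v + 2) + 1); last by ring.
rewrite (_ : m%:R + 1 + v + 1 = m%:R + v + 2); last by ring.
rewrite (_ : m%:R + (v + 2) + 1 = (m%:R + v + 2) + 1); last by ring.
rewrite (_ : (m%:R + 1) *+ 2 + (v + 1) = (m%:R *+ 2 + (v + 2)) + 1); last by ring.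
rewrite (_ : m%:R *+ 2 + (v + 2) = ((m%:R + 1) *+ 2 + v)); last by ring.
rewrite GammaD1// powRD ?(gt_eqF r20) ?implybT// powRr1 ?ltW//.
rewrite factS natrM exprS -[m.+1%:R]natr1.
by field; rewrite !gt_eqF.
Qed.

Lemma bessel_rec v r : -1 < v -> 0 < r ->
  bessel (v + 2) r = 2 * (v + 1) / r * bessel (v + 1) r - bessel v r.
Proof.
(* Because of this shift of index, n terms on the left correspond to n + 1 terms on the right. The
   claim follows in the limit. *)
move=> v1 r0; have seriesE n : series (bessel_term (v + 2) r) n =
    2 * (v + 1) / r * series (bessel_term (v + 1) r) n.+1 -
    series (bessel_term v r) n.+1.
  elim: n => [|n IH].
    by rewrite /series /= !big_nat1 bessel_term_rec0// big_geq.
  rewrite seriesSr /= IH [series (bessel_term (v + 1) r) n.+2]seriesSr.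
  rewrite [series (bessel_term v r) n.+2]seriesSr /=.
  by rewrite -bessel_term_recS//; ring.
have cvg2 : series (bessel_term (v + 2) r) n @[n --> \oo] --> bessel (v + 2) r.
  by apply: bessel_cvg => //; lra.
move: cvg2; under eq_fun do rewrite seriesE.
move=> /cvg_unique; apply => //.
apply: cvgB; [apply: cvgMl_tmp|].
- by rewrite (cvg_shiftS (series (bessel_term (v + 1) r))); apply: bessel_cvg => //; lra.
- by rewrite (cvg_shiftS (series (bessel_term v r))); exact: bessel_cvg.
Qed.

(* The series alternates and, as [(r / 2) ^+ 2 < v + 1], its terms decrease in
   absolute value. *)
Lemma bessel_gt0 v r : -1 < v -> 0 < r -> (r / 2) ^+ 2 < v + 1 ->
  0 < bessel v r.
Proof.
move=> v1 r0 rv; have v10 : 0 < v + 1 by lra.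
pose t := bessel_term v r.
have t_even m : 0 < t m.*2.
  rewrite /t /bessel_term -mul2n exprM sqrrN !expr1n mul1r.
  have m0 : 0 <= (2 * m)%:R :> R by exact: ler0n.
  rewrite mulr_gt0 ?powR_gt0//; last by lra.
  by rewrite invr_gt0 mulr_gt0 ?ltr0n ?fact_gt0// Gamma_gt0//; lra.
have t_pair m : 0 < t m.*2 + t m.*2.+1.
  rewrite /t bessel_termS// -/(t _) mulNr -{1}[t _]mul1r -mulrBl mulr_gt0//.
  rewrite subr_gt0 ltr_pdivrMr ?mul1r.
    apply: (lt_le_trans rv); rewrite -[leLHS]mul1r ler_pM ?ler1n//; first lra.
    by rewrite -addrA lerDr.
  by rewrite mulr_gt0 ?ltr0n// -addrA ltr_wpDl.
(* Grouping the terms in pairs bounds the partial sums of even length below by a fixed positive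
   number, so positivity survives in the limit. *)
have series_ge n : t 0 + t 1 <= series t n.+1.*2.
  elim: n => [|n IH]; first by rewrite /series /= big_nat_recr//= big_nat1.
  rewrite doubleS 2!seriesSr /= -addrA; apply: (le_trans IH).
  by rewrite lerDl ltW// t_pair.
apply: (@lt_le_trans _ _ (t 0 + t 1)); first exact: (t_pair 0).
rewrite leNgt; apply/negP => bessel_lt.
have [N _ /(_ N.+1.*2)] := cvgr_lt _ (bessel_cvg _ _ v1 r0) _ bessel_lt.
rewrite /= ltNge series_ge => /(_ _)/negP []//.
by rewrite /= -addnn; lia.
Qed.

Lemma bessel_no_common_zero v r : -1 < v -> 0 < r ->
  bessel v r = 0 -> bessel (v + 1) r <> 0.
Proof.
move=> v1 r0 J0 J1.
have J_eq0 n : bessel (v + n%:R) r = 0 /\ bessel (v + n.+1%:R) r = 0.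
  elim: n => [|n [IH0 IH1]]; first by rewrite addr0.
  split=> //; have n0 : 0 <= n%:R :> R by exact: ler0n.
  rewrite (_ : v + n.+2%:R = v + n%:R + 2); last by rewrite -addn2 natrD; ring.
  rewrite bessel_rec//; last by lra.
  by rewrite (_ : v + n%:R + 1 = v + n.+1%:R) ?IH0 ?IH1 ?mulr0 ?subr0// -natr1 addrA.
(* As v + 1 > 0, this n gives (r/2)^2 < v + n + 1, the condition of [bessel_gt0] at index v + n. *)
have /archi_boundP := sqr_ge0 (r / 2); set n := Num.bound _ => rn.
have n0 : 0 <= n%:R :> R by exact: ler0n.
have [J_n _] := J_eq0 n.
have : 0 < bessel (v + n%:R) r by apply: bessel_gt0; lra.
by rewrite J_n ltxx.
Qed.

End Bessel_function.

(** * The polynomials a_l and the partial functions G *)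

(** As a difference of two solutions of the linear recurrence, this is again a solution, with
    initial values 0 and 1. *)
Definition aslope {R : realType} (k : R) (l : nat) (r : R) : R :=
  a k l 0 r - a k l 1 r.

Lemma aSS {R : realType} (k : R) l (y r : R) :
  a k l.+2 y r = 2 * (k + 2 + l%:R) * a k l.+1 y r - r ^+ 2 * a k l y r.
Proof. by []. Qed.

Lemma aslopeSS {R : realType} (k : R) l (r : R) :
  aslope k l.+2 r = 2 * (k + 2 + l%:R) * aslope k l.+1 r - r ^+ 2 * aslope k l r.
Proof. by rewrite /aslope !aSS; ring. Qed.

Lemma aslope0 {R : realType} (k : R) (r : R) : aslope k 0 r = 0.
Proof. by rewrite /aslope /=; ring. Qed.

Lemma aslope1 {R : realType} (k : R) (r : R) : aslope k 1 r = 1.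
Proof. by rewrite /aslope /=; ring. Qed.

Lemma nat_ind2 (P : nat -> Prop) :
  P 0%N -> P 1%N -> (forall n, P n -> P n.+1 -> P n.+2) -> forall n, P n.
Proof.
move=> P0 P1 PSS n; suff [] : P n /\ P n.+1 by [].
by elim: n => [//|n [Pn PSn]]; split=> //; exact: PSS.
Qed.

Lemma a_affine {R : realType} (k : R) l (y r : R) :
  a k l y r = a k l 0 r - y * aslope k l r.
Proof.
elim/nat_ind2: l => [||l IH0 IH1].
- by rewrite aslope0 /=; ring.
- by rewrite aslope1 /=; ring.
- by rewrite !aSS aslopeSS IH0 IH1; ring.
Qed.

Lemma G_definedP {R : realType} (k : R) l (r : R) :
  G_defined k l.+1 r <-> aslope k l r != 0.
Proof.
rewrite /G_defined /=; split=> [[y [ay y_uniq]]|q_neq0].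
  (* With slope 0 the value of a_l does not depend on y, so y + 1 would be a second solution. *)
  apply/eqP => q_eq0; have : y = y + 1.
    by apply: y_uniq; rewrite -ay !(a_affine _ _ (y + _)) (a_affine _ _ y) q_eq0 !mulr0.
  by move=> ?; lra.
exists (a k l 0 r / aslope k l r); split=> [|y].
  by rewrite a_affine divfK// subrr.
rewrite a_affine => /eqP; rewrite subr_eq0 => /eqP ->.
by rewrite mulfK.
Qed.

Lemma GE {R : realType} (k : R) l (r : R) : aslope k l r != 0 ->
  G k l.+1 r = a k l 0 r / aslope k l r.
Proof.
move=> q_neq0; rewrite /G /=.
have /getPex /= : exists y : R, a k l y r = 0.
  by exists (a k l 0 r / aslope k l r); rewrite a_affine divfK// subrr.
set y := get _; rewrite a_affine => /eqP; rewrite subr_eq0 => /eqP ->.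
by rewrite mulfK.
Qed.

(** The determinant of the two solutions is 1 at l = 0. Each step of the recurrence multiplies it by
    r^2, since the middle terms cancel. *)
Lemma casoratian {R : realType} (k : R) l (r : R) :
  a k l 0 r * aslope k l.+1 r - a k l.+1 0 r * aslope k l r = r ^+ (2 * l).
Proof.
elim: l => [|l IH]; first by rewrite aslope0 aslope1 /=; ring.
by rewrite aSS aslopeSS mulnS exprD -IH; ring.
Qed.

(** If the slope vanished too, then a_l(0) would be 0, and the Casoratian with it, although r^(2l)
    is nonzero. *)
Lemma a_eq0_aslope_neq0 {R : realType} (k : R) l (y r : R) : 0 < r ->
  a k l y r = 0 -> aslope k l r != 0.
Proof.
move=> r0 ay; apply/eqP => q_eq0.
have := casoratian k l r; move: ay; rewrite a_affine q_eq0 !mulr0 !subr0 => ->.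
by rewrite mul0r => /esym/eqP; rewrite expf_eq0 gt_eqF ?andbF.
Qed.

Lemma a_poly {R : realType} (k : R) l (y : R) :
  exists p : {poly R}, forall r, p.[r] = a k l y r.
Proof.
elim/nat_ind2: l => [||l [p0 p0E] [p1 p1E]].
- by exists 1 => r; rewrite hornerE.
- by exists (2 * (k + 1) - y)%:P => r; rewrite hornerE.
- exists ((2 * (k + 2 + l%:R))%:P * p1 - 'X^2 * p0) => r.
  by rewrite aSS -p0E -p1E !hornerE.
Qed.

(** At r = 0 the recurrence reduces to multiplication by the positive factors 2(k + 2 + l). This
    shows that the slope is not the zero polynomial in r, hence that G has finitely many poles. *)
Lemma aslope_at0_gt0 {R : realType} (k : R) l : -1 < k -> 0 < aslope k l.+1 0.
Proof.
move=> hk; elim: l => [|l IH]; first by rewrite aslope1.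
have l_ge0 : 0 <= l%:R :> R by exact: ler0n.
by rewrite aslopeSS expr0n /= mul0r subr0 mulr_gt0//; lra.
Qed.

Lemma finite_roots {R : realType} (p : {poly R}) : p != 0 ->
  finite_set [set r | p.[r] = 0].
Proof.
move=> p_neq0; apply: contrapT => /(infinite_set_fset (size p))[B Broot].
apply/negP; rewrite -ltnNge; apply: max_poly_roots => //; last exact: finmap.fset_uniq.
by apply/allP => r rB; apply/eqP/Broot.
Qed.

Lemma finite_aslope_roots {R : realType} (k : R) l : -1 < k ->
  finite_set [set r | aslope k l.+1 r = 0].
Proof.
move=> hk; have [p0 p0E] := a_poly k l.+1 0; have [p1 p1E] := a_poly k l.+1 1.
have pE r : (p0 - p1).[r] = aslope k l.+1 r by rewrite !hornerE p0E p1E.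
rewrite (_ : [set r | _] = [set r | (p0 - p1).[r] = 0]).
  apply: finite_roots; apply: contraTneq (aslope_at0_gt0 k l hk) => p_eq0.
  by rewrite -pE p_eq0 horner0 ltxx.
by apply/seteqP; split=> r /=; rewrite pE.
Qed.

(** Reduces each closed form to two polynomial identities, one for the slope d and one for a_l(0),
    both within reach of [ring]. In the applications c = 2(k + 1). *)
Lemma G_formula {R : realType} (k r c n d : R) l :
  aslope k l r = d -> a k l 0 r = c * d - n ->
  (G_defined k l.+1 r <-> d != 0) /\
  (G_defined k l.+1 r -> G k l.+1 r = c - n / d).
Proof.
move=> <- aE; have defE := G_definedP k l r.
by split=> // /defE q_neq0; rewrite GE// aE; field.
Qed.

(** * Zeros of Bessel functions as intersections of the graphs of F and G *)

(** Both sides satisfy the same recurrence in l. They agree trivially at l = 0, and at l = 1 by the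
    Bessel recurrence. *)
Lemma bessel_a {R : realType} (k r : R) l : -1 < k -> 0 < r ->
  r ^+ l * bessel (k + 1 + l%:R) r =
  a k l 0 r * bessel (k + 1) r - aslope k l r * (r * bessel k r).
Proof.
move=> k1 r0; elim/nat_ind2: l => [||l IH0 IH1].
- by rewrite aslope0 addr0 expr0 /=; ring.
- rewrite aslope1 (_ : k + 1 + 1 = k + 2); last by ring.
  by rewrite bessel_rec//= expr1; field; rewrite gt_eqF.
have l0 : 0 <= l%:R :> R by exact: ler0n.
rewrite aSS aslopeSS (_ : k + 1 + l.+2%:R = k + 1 + l%:R + 2); last first.
  by rewrite -addn2 natrD; ring.
rewrite bessel_rec//; last by lra.
move: IH1; rewrite (_ : k + 1 + l.+1%:R = k + 1 + l%:R + 1); last first.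
  by rewrite -natr1; ring.
set J1 := bessel _ _; set J0 := bessel _ r in IH0 *; move=> IH1.
(* The Bessel recurrence at index k + 1 + l, multiplied by r^(l+2): one factor r absorbs the
   denominator. *)
transitivity (2 * (k + 2 + l%:R) * (r ^+ l.+1 * J1) - r ^+ 2 * (r ^+ l * J0)).
  by rewrite !exprS; field; rewrite gt_eqF.
by rewrite IH0 IH1; ring.
Qed.

Lemma bessel_a_F {R : realType} (k r : R) l : -1 < k -> 0 < r ->
  bessel (k + 1) r != 0 ->
  r ^+ l * bessel (k + 1 + l%:R) r = a k l (F k r) r * bessel (k + 1) r.
Proof.
by move=> k1 r0 J1; rewrite bessel_a// (a_affine _ _ (F k r)) /F; field.
Qed.

Lemma bessel_eq0_F {R : realType} (k r : R) l : -1 < k -> 0 < r ->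
  bessel (k + 1) r != 0 ->
  (bessel (k + 1 + l%:R) r = 0) <-> (a k l (F k r) r = 0).
Proof.
move=> k1 r0 J1; have := bessel_a_F _ _ l k1 r0 J1 => E; split=> [J0|a0].
  move: E; rewrite J0 mulr0 => /esym/eqP.
  by rewrite mulf_eq0 (negbTE J1) orbF => /eqP.
move: E; rewrite a0 mul0r => /eqP.
by rewrite mulf_eq0 expf_eq0 (gt_eqF r0) andbF => /eqP.
Qed.

Lemma bessel_eq0_aslope {R : realType} (k r : R) l : -1 < k -> 0 < r ->
  bessel (k + 1) r = 0 ->
  (bessel (k + 1 + l%:R) r = 0) <-> (aslope k l r = 0).
Proof.
move=> k1 r0 J1; have := bessel_a _ _ l k1 r0; rewrite J1 mulr0 sub0r => E.
have J0 : bessel k r != 0.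
  by apply/eqP => J0; apply: (bessel_no_common_zero _ _ k1 r0 J0).
split=> [Jl|ql].
  move: E; rewrite Jl mulr0 => /esym/eqP; rewrite oppr_eq0 !mulf_eq0.
  by rewrite (negbTE J0) (gt_eqF r0) !orbF => /eqP.
move: E; rewrite ql mul0r oppr0 => /eqP.
by rewrite mulf_eq0 expf_eq0 (gt_eqF r0) andbF => /eqP.
Qed.

Lemma bessel_zeros_graphs {R : realType} (k : R) l : -1 < k ->
  bessel_zeros (k + 1 + l%:R) `\` bessel_zeros (k + 1) =
  fst @` (graph_F k `&` graph_G k l.+1).
Proof.
move=> k1; apply/seteqP; split=> r /=.
  case=> -[r0 Jl] J1; have {}J1 : bessel (k + 1) r != 0.
    by apply/eqP => J1_eq0; apply: J1.
  have aF := (bessel_eq0_F _ _ _ k1 r0 J1).1 Jl.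
  have q_neq0 := a_eq0_aslope_neq0 _ _ _ _ r0 aF.
  (* The slope being nonzero, F_k(r) is the only root of a_l in y, so it equals G_{k,l+1}(r). *)
  exists (r, F k r) => //; split; first by split.
  split=> //=; first exact/G_definedP.
  rewrite GE//; move: aF; rewrite a_affine => /eqP.
  by rewrite subr_eq0 => /eqP ->; rewrite mulfK.
case=> -[r' y] [[/= r0 J1 yF] [/= _ Gd yG]] <- {r}.
split; last by case=> _ /eqP; rewrite (negbTE J1).
split=> //; apply/(bessel_eq0_F _ _ _ k1 r0 J1).
have q_neq0 := (G_definedP _ _ _).1 Gd.
by rewrite -yF yG GE// a_affine divfK// subrr.
Qed.

Lemma bessel_zeros_common_poles {R : realType} (k : R) l : -1 < k ->
  bessel_zeros (k + 1 + l%:R) `&` bessel_zeros (k + 1) = common_poles k l.+1.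
Proof.
move=> k1; apply/seteqP; split=> r /=.
  case=> -[r0 Jl] [_ J1]; split=> //.
  by rewrite G_definedP (bessel_eq0_aslope _ _ _ k1 r0 J1).1// eqxx.
case=> r0 J1 /G_definedP/negP; rewrite negbK => /eqP ql.
by split=> //; split=> //; apply/(bessel_eq0_aslope _ _ _ k1 r0 J1).
Qed.

Theorem theorem3 (R : realType) (k : R) (l : nat) (hk : -1 < k) (hl : (0 < l)%N) :
  [/\ finite_set [set r : R | 0 < r /\ ~ G_defined k l.+1 r],
      bessel_zeros (k + 1 + l%:R) `\` bessel_zeros (k + 1) =
        fst @` (graph_F k `&` graph_G k l.+1),
      bessel_zeros (k + 1 + l%:R) `&` bessel_zeros (k + 1) =
        common_poles k l.+1,
      (forall j : nat -> R, enumerates_bessel_zeros (k + 1 + l%:R) j ->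
        range j = fst @` (graph_F k `&` graph_G k l.+1) `|` common_poles k l.+1)
    & forall r : R, 0 < r ->
      (G_defined k 2 r /\
       G k 2 r = 2 * (k + 1)) /\
      (G_defined k 3 r /\
       G k 3 r = 2 * (k + 1) - r ^+ 2 / (2 * (k + 2))) /\
      ((G_defined k 4 r <-> 4 * (k + 2) * (k + 3) - r ^+ 2 != 0) /\
       (G_defined k 4 r ->
        G k 4 r = 2 * (k + 1) -
          2 * (k + 3) * r ^+ 2 / (4 * (k + 2) * (k + 3) - r ^+ 2))) /\
      ((G_defined k 5 r <-> 4 * (k + 3) * (2 * (k + 2) * (k + 4) - r ^+ 2) != 0) /\
       (G_defined k 5 r ->
        G k 5 r = 2 * (k + 1) -
          (4 * (k + 3) * (k + 4) - r ^+ 2) * r ^+ 2 /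
            (4 * (k + 3) * (2 * (k + 2) * (k + 4) - r ^+ 2)))) /\
      ((G_defined k 6 r <->
        16 * (k + 5) * (k + 4) * (k + 3) * (k + 2)
          - 12 * (k + 3) * (k + 4) * r ^+ 2 + r ^+ 4 != 0) /\
       (G_defined k 6 r ->
        G k 6 r = 2 * (k + 1) -
          4 * (k + 4) * (2 * (k + 3) * (k + 5) - r ^+ 2) * r ^+ 2 /
            (16 * (k + 5) * (k + 4) * (k + 3) * (k + 2)
              - 12 * (k + 3) * (k + 4) * r ^+ 2 + r ^+ 4))) /\
      ((G_defined k 7 r <->
        2 * (k + 4) * (16 * (k + 6) * (k + 5) * (k + 3) * (k + 2)
          - 16 * (k + 5) * (k + 3) * r ^+ 2 + 3 * r ^+ 4) != 0) /\
       (G_defined k 7 r ->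
        G k 7 r = 2 * (k + 1) -
          (16 * (k + 6) * (k + 5) * (k + 4) * (k + 3)
            - 12 * (k + 5) * (k + 4) * r ^+ 2 + r ^+ 4) * r ^+ 2 /
            (2 * (k + 4) * (16 * (k + 6) * (k + 5) * (k + 3) * (k + 2)
              - 16 * (k + 5) * (k + 3) * r ^+ 2 + 3 * r ^+ 4))))].
Proof.
split; [|exact: bessel_zeros_graphs|exact: bessel_zeros_common_poles| |].
(* Positivity of l matters here: [aslope k 0] vanishes identically, whereas for a successor it has
   finitely many roots. *)
- case: l hl => // l _.
  apply: sub_finite_set (finite_aslope_roots k l hk) => r /= [_ /G_definedP/negP].
  by rewrite negbK => /eqP.
- move=> j [_ ->].
  (* The zeros of J_{k+1+l} split into those that are zeros of J_{k+1} and those that are not. *)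
  by rewrite -bessel_zeros_graphs// -bessel_zeros_common_poles// setUC setUIDK.
- move=> r _.
  (* The quotient 0 / 1 puts the constant G_{k,2} in the shape of [G_formula]. *)
  have [G2d G2E] : (G_defined k 2 r <-> 1 != 0 :> R) /\
      (G_defined k 2 r -> G k 2 r = 2 * (k + 1) - 0 / 1).
    by apply: G_formula; rewrite /aslope /=; ring.
  have [G3d G3E] : (G_defined k 3 r <-> 2 * (k + 2) != 0) /\
      (G_defined k 3 r -> G k 3 r = 2 * (k + 1) - r ^+ 2 / (2 * (k + 2))).
    by apply: G_formula; rewrite /aslope /=; ring.
  (* The slopes 1 and 2(k + 2) never vanish for k > -1, so G_{k,2} and G_{k,3} have no poles. *)
  have {}G2d : G_defined k 2 r by apply/G2d; rewrite oner_neq0.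
  have {}G3d : G_defined k 3 r by apply/G3d; rewrite gt_eqF//; lra.
  split; first by rewrite G2E// divr1 subr0.
  split; first by split=> //; exact: G3E.
  by split; [|split; [|split]]; apply: G_formula; rewrite /aslope /=; ring.
Qed.
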